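(* Let $D$ be an integral domain and let $S$ be a splitting multiplicative set of $D$. If $D$ is a $v$-domain, then so is $D_S$. Moreover, if $S$ is an lcm splitting set, then $D_S$ is a $v$-domain if and only if $D$ is a $v$-domain.
   Context: Let $D$ be an integral domain with quotient field $K$. For a nonzero fractional ideal $A$ of $D$, $A^{-1}=\{x\in K : xA\subseteq D\}$ and $A_v=(A^{-1})^{-1}$. For $a,b\in D$ not both zero, $(a,b)$ is the ideal they generate and $(a,b)_v$ its $v$-image. $D$ is a $v$-domain if for every nonzero finitely generated ideal $A$ of $D$ one has $(AA^{-1})^{-1}=D$, equivalently $(AA^{-1})_v=D$. Multiplicative sets do not contain $0$; $D_S$ is the ring of fractions of $D$ with respect to $S$. A multiplicative set $S$ of $D$ is a splitting set if $S$ is saturated and each $d\in D\setminus\{0\}$ can be written as $d=d's$ with $s\in S$ and $d'\in D$ such that $(d',t)_v=D$ for all $t\in S$. A splitting set $S$ of $D$ is an lcm splitting set if $sD\cap xD$ is principal for all $s\in S$ and all $x\in D\setminus\{0\}$. *)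

(* Defs.v *)
From HB Require Import structures.
From mathcomp Require Import all_boot all_order all_algebra.
From mathcomp Require Import fraction.
From mathcomp Require Import boolp classical_sets.
Set Implicit Arguments.
Unset Strict Implicit.
Unset Printing Implicit Defensive.
Import GRing.Theory.
Local Open Scope classical_set_scope.
Local Open Scope ring_scope.

Section Ideals.
Variable D : idomainType.

Definition ideal_gen (g : seq D) : set D :=
  [set x | exists c : 'I_(size g) -> D, x = \sum_i c i * g`_i].

(* D, and subsets of D, viewed inside the quotient field {fraction D}. *)
Definition dom_in_frac : set {fraction D} := range (@tofrac D).

Definition set_in_frac (A : set D) : set {fraction D} := @tofrac D @` A.

Definition ideal_inv (A : set {fraction D}) : set {fraction D} :=
  [set x | forall a, A a -> dom_in_frac (x * a)].

Definition ideal_v (A : set {fraction D}) : set {fraction D} :=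
  ideal_inv (ideal_inv A).

(* The product of fractional ideals: finite sums of products. *)
Definition ideal_mul (A B : set {fraction D}) : set {fraction D} :=
  [set x | exists n (a b : 'I_n -> {fraction D}),
    [/\ forall i, A (a i), forall i, B (b i) & x = \sum_i a i * b i]].

Definition is_fg_ideal (I : set D) : Prop := exists g : seq D, I = ideal_gen g.

Definition is_principal_ideal (I : set D) : Prop :=
  exists c : D, I = ideal_gen [:: c].

Definition v_domain : Prop :=
  forall I : set D, is_fg_ideal I -> I <> [set 0] ->
    let A := set_in_frac I in
    ideal_inv (ideal_mul A (ideal_inv A)) = dom_in_frac.

Record multset := MultSet {
  mset :> D -> Prop;
  mset0 : ~ mset 0;
  mset1 : mset 1;
  msetM : forall x y, mset x -> mset y -> mset (x * y)
}.

Definition saturated (S : multset) : Prop :=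
  forall x y : D, S (x * y) -> S x /\ S y.

Definition splitting_set (S : multset) : Prop :=
  saturated S /\
  forall d : D, d != 0 ->
    exists d' s : D, [/\ d = d' * s, S s &
      forall t, S t -> ideal_v (set_in_frac (ideal_gen [:: d'; t])) = dom_in_frac].

Definition lcm_splitting_set (S : multset) : Prop :=
  splitting_set S /\
  forall s x : D, S s -> x != 0 ->
    is_principal_ideal (ideal_gen [:: s] `&` ideal_gen [:: x]).

End Ideals.

(* The ring of fractions D_S, as the subring of {fraction D} of all d / s with
   s in S. Membership is made boolean with asbool in order to use subtypes. *)
Section Localization.
Variables (D : idomainType) (S : multset D).

Definition frac_by : {pred {fraction D}} := fun x =>
  `[< exists d s : D, S s /\ x = tofrac d / tofrac s >].

Lemma mset_tofrac_neq0 (s : D) : S s -> tofrac s != 0.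
Proof.
by move=> Ss; rewrite tofrac_eq0; apply/eqP => s0; apply: (@mset0 _ S); rewrite -s0.
Qed.

Fact frac_by_subring : subring_closed frac_by.
Proof.
split.
- by apply/asboolP; exists 1, 1; split; [exact: mset1 | rewrite tofrac1 divr1].
- move=> _ _ /asboolP[a [s [Ss ->]]] /asboolP[b [t [St ->]]].
  apply/asboolP; exists (a * t - b * s), (s * t); split; first exact: msetM.
  by rewrite -mulNr addf_div ?mset_tofrac_neq0// tofracB !tofracM mulNr.
- move=> _ _ /asboolP[a [s [Ss ->]]] /asboolP[b [t [St ->]]].
  apply/asboolP; exists (a * b), (s * t); split; first exact: msetM.
  by rewrite mulf_div !tofracM.
Qed.

HB.instance Definition _ :=
  GRing.isSubringClosed.Build {fraction D} frac_by frac_by_subring.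

Record localization := Localize {
  loc_val : {fraction D};
  loc_valP : loc_val \in frac_by
}.

HB.instance Definition _ := [isSub for loc_val].
HB.instance Definition _ := [Choice of localization by <:].
HB.instance Definition _ := [SubChoice_isSubComNzRing of localization by <:].

Definition loc_unit : {pred localization} := fun x =>
  (val x != 0) && ((val x)^-1 \in frac_by).

Definition loc_inv (x : localization) : localization := insubd x (val x)^-1.

Fact loc_mulVx : {in loc_unit, left_inverse 1 loc_inv *%R}.
Proof.
move=> x /andP[x0 xV]; apply: val_inj.
by rewrite rmorphM rmorph1 /loc_inv /= insubdK// mulVf.
Qed.

Fact loc_unitPl (x y : localization) : y * x = 1 -> loc_unit x.
Proof.
move=> yx1; have {}yx1 : val y * val x = 1 by rewrite -rmorphM yx1 rmorph1.
have x0 : val x != 0.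
  by apply: contra_eq_neq yx1 => ->; rewrite mulr0 eq_sym oner_eq0.
rewrite /loc_unit x0 /= -[X in X \in _]mul1r -yx1 mulfK//; exact: valP.
Qed.

Fact loc_inv_out : {in [predC loc_unit], loc_inv =1 id}.
Proof.
move=> x xU; apply: val_inj; rewrite /loc_inv val_insubd.
case: ifP => // xV; move: xU; rewrite inE /= unfold_in xV andbT negbK => /eqP x0.
by move: (x0 : val x = 0) => {}x0; rewrite x0 invr0.
Qed.

HB.instance Definition _ := GRing.ComNzRing_hasMulInverse.Build localization
  loc_mulVx loc_unitPl loc_inv_out.

Fact loc_integral : GRing.integral_domain_axiom localization.
Proof.
move=> x y xy0; have /eqP : val x * val y = 0 by rewrite -rmorphM xy0 rmorph0.
by rewrite mulf_eq0 => /orP[]/eqP h; apply/orP; [left|right];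
  apply/eqP/val_inj; rewrite h rmorph0.
Qed.

HB.instance Definition _ :=
  GRing.ComUnitRing_isIntegral.Build localization loc_integral.

End Localization.

(* Main.v *)
Require Import Defs.
From mathcomp Require Import all_boot all_order all_algebra.
From mathcomp Require Import fraction ring.
From mathcomp Require Import boolp classical_sets.

(** Since (A A^-1)^-1 is the set of x with x A^-1 contained in A^-1, a domain
    is a v-domain when, for every nonzero finitely generated A, the only
    fractions x with x A^-1 in A^-1 are the elements of the domain.  Writing
    the fractions as x = a / b and y = p / q turns this into a condition on
    divisibility, [multiplier_closed] below ([v_domainE]).  Fractional ideals
    of D_S can be scaled to be generated by elements of D, and divisibility in
    D_S is divisibility in D up to a factor in S; so D_S is a v-domain when the
    same condition holds in D for that coarser relation
    ([v_domain_localizationE]).  Both implications are then statements about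
    the elements of D.

    From D to D_S ([localization_multiplier_closed]).  Let x A^-1 be contained
    in A^-1 over D_S.  After multiplying x by an element of S, its denominator
    b is v-coprime to S.  For y in the inverse of A over D and u in A, the
    element x y u lies in D_S and b x y u lies in D, so x y u has one
    denominator in S and another one, b, v-coprime to it: x y u is in D.  Thus
    x A^-1 is contained in A^-1 over D, so this multiple of the original x is in
    D, and the original x is in D_S.

    From D_S to D, for S an lcm splitting set
    ([multiplier_closed_of_localization]).  Let x A^-1 be contained in A^-1
    over D.  As A is finitely generated, A^-1 generates the inverse of A over
    D_S, so x is in D_S.  Elements of S have greatest common divisors with all
    nonzero elements, so x = d / s with s in S coprime to d, and the generators
    of A have a greatest common divisor g among the elements of S.  Now 1 / g
    is in A^-1, hence so is x / g = d / (s g).  Therefore s g divides every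
    generator of A, hence g, and s is a unit. *)

Set Implicit Arguments.
Unset Strict Implicit.
Unset Printing Implicit Defensive.
Import GRing.Theory.
Local Open Scope classical_set_scope.
Local Open Scope ring_scope.

(** * Divisibility and fractions *)

Definition divides (R : idomainType) (a b : R) : Prop := exists c, b = c * a.

Section Fractions.
Variable R : idomainType.
Implicit Types (a b c d p q u : R) (l : seq R).

Lemma fractionP (x : {fraction R}) :
  exists a b, b != 0 /\ x = tofrac a / tofrac b.
Proof.
elim/quotW: x => r; exists (\n_r), (\d_r); have d0 := denom_ratioP r.
split=> //; apply: (@mulIf _ (tofrac (\d_r))); first by rewrite tofrac_eq0.
rewrite divfK ?tofrac_eq0//; unlock FracField.tofrac.
rewrite -[LHS]FracField.pi_mul; apply/eqmodP.
rewrite /= /FracField.equivf /FracField.mulf.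
by rewrite !numden_Ratio ?oner_eq0 ?mulr1// mulrC.
Qed.

Lemma dom_in_frac_div a b :
  b != 0 -> dom_in_frac (tofrac a / tofrac b) <-> divides b a.
Proof.
move=> b0; have b0F : tofrac b != 0 by rewrite tofrac_eq0.
split=> [[c _ /= cE]|[c ->]]; exists c => //.
  by apply/eqP; rewrite -tofrac_eq tofracM cE divfK.
by rewrite tofracM mulfK.
Qed.

Lemma dom_in_frac_sum n (f : 'I_n -> {fraction R}) :
  (forall i, dom_in_frac (f i)) -> dom_in_frac (\sum_i f i).
Proof.
move=> fD; apply: (big_ind (@dom_in_frac R)) => //.
- by exists 0 => //; rewrite tofrac0.
- by move=> _ _ [a _ <-] [b _ <-]; exists (a + b) => //; rewrite tofracD.
Qed.

Lemma mem_ideal_gen l u : u \in l -> ideal_gen l u.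
Proof.
move=> ul; have ilt : (index u l < size l)%N by rewrite index_mem.
exists (fun i => (i == Ordinal ilt)%:R).
rewrite (bigD1 (Ordinal ilt))//= eqxx mul1r nth_index// big1 ?addr0// => i.
by move=> /negPf ->; rewrite mul0r.
Qed.

Lemma ideal_gen_neq0 l :
  ideal_gen l <> [set 0] <-> exists2 u, u \in l & u != 0.
Proof.
split=> [l0|[u ul u0] lE]; last first.
  by have := mem_ideal_gen ul; rewrite lE => /= uE; rewrite uE eqxx in u0.
apply: contrapT => nl; apply: l0; apply/seteqP; split=> [x [c ->]|_ ->] /=.
  rewrite big1// => i _; have [->|ui] := eqVneq l`_i 0; first by rewrite mulr0.
  by case: nl; exists l`_i => //; apply: mem_nth.
by exists (fun=> 0); rewrite big1// => i _; rewrite mul0r.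
Qed.

Lemma ideal_gen1 a x : ideal_gen [:: a] x <-> divides a x.
Proof.
split=> [[c ->]|[c ->]]; first by exists (c ord0); rewrite big_ord1.
by exists (fun=> c); rewrite big_ord1.
Qed.

Lemma ideal_inv_gen l (x : {fraction R}) :
  ideal_inv (set_in_frac (ideal_gen l)) x <->
  forall u, u \in l -> dom_in_frac (x * tofrac u).
Proof.
split=> [xl u ul|xl _ [_ [c ->] <-]].
  by apply: xl; exists u => //; apply: mem_ideal_gen.
rewrite rmorph_sum mulr_sumr; apply: dom_in_frac_sum => i.
have [e _ eE] := xl _ (mem_nth 0 (ltn_ord i)).
by exists (c i * e) => //; rewrite /= !tofracM eE mulrCA.
Qed.

Lemma ideal_inv_mul (A B : set {fraction R}) x :
  ideal_inv (ideal_mul A B) x <->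
  forall y z, B y -> A z -> dom_in_frac (x * y * z).
Proof.
split=> [xAB y z By Az|xAB _ [n [z [y [Az By ->]]]]].
  rewrite -mulrA [y * z]mulrC; apply: xAB.
  by exists 1%N, (fun=> z), (fun=> y); split=> //; rewrite big_ord1.
rewrite mulr_sumr; apply: dom_in_frac_sum => i.
by rewrite [z i * _]mulrC mulrA; apply: xAB.
Qed.

End Fractions.

(** * Being a v-domain as a divisibility condition *)

(** Read with x = a / b and y = p / q, and with A the ideal generated by l: if
    x y is in A^-1 for all y in A^-1, then x is in the domain.  The relation dv
    is a parameter because divisibility in D and in D_S can both be expressed
    on the elements of D. *)
Definition multiplier_closed (R : idomainType) (dv : R -> R -> Prop) : Prop :=
  forall l : seq R, (exists2 u, u \in l & u != 0) ->
  forall a b, b != 0 ->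
  (forall p q, q != 0 -> (forall u, u \in l -> dv q (p * u)) ->
     forall u, u \in l -> dv (b * q) (a * p * u)) ->
  dv b a.

Lemma v_domainE (R : idomainType) :
  v_domain R <-> multiplier_closed (@divides R).
Proof.
have fracM (a b p q u : R) :
    tofrac a / tofrac b * (tofrac p / tofrac q) * tofrac u =
    tofrac (a * p * u) / tofrac (b * q).
  by rewrite !tofracM invfM; ring.
split=> [vR l l0 a b b0 ab|mR _ [l ->] /ideal_gen_neq0 l0 /=].
  apply/(dom_in_frac_div _ b0).
  rewrite -(vR _ (ex_intro _ l erefl) ((ideal_gen_neq0 l).2 l0)).
  apply/ideal_inv_mul => y _ + [_ [c ->] <-].
  have [p [q [q0 ->]]] := fractionP y => /ideal_inv_gen pq.
  move: (\sum_i c i * l`_i) (ex_intro _ c erefl : ideal_gen l _) => v vl.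
  have /ideal_inv_gen xl : forall u, u \in l ->
      dom_in_frac (tofrac a / tofrac b * (tofrac p / tofrac q) * tofrac u).
    move=> u ul; rewrite fracM; apply/dom_in_frac_div; first exact: mulf_neq0.
    apply: (ab p q q0 _ u ul) => w wl; apply/(dom_in_frac_div _ q0).
    by rewrite tofracM mulrAC; apply: pq.
  by apply: xl; exists v.
apply/seteqP; split=> [x /ideal_inv_mul|_ [c _ <-]]; last first.
  apply/ideal_inv_mul => y _ yl [v vl <-]; rewrite -mulrA.
  have [e _ <-] := yl _ (ex_intro2 _ _ v vl erefl).
  by exists (c * e) => //; rewrite tofracM.
have [a [b [b0 ->]]] := fractionP x => xl.
apply/(dom_in_frac_div _ b0); apply: (mR l l0) => // p q q0 pq u ul.
apply/(dom_in_frac_div _ (mulf_neq0 b0 q0)).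
rewrite -fracM; apply: xl; last by exists u => //; apply: mem_ideal_gen.
apply/ideal_inv_gen => w wl; rewrite mulrAC -tofracM.
by apply/(dom_in_frac_div _ q0); apply: pq.
Qed.

(** * Divisibility in the ring of fractions *)

Section LocalizationDivisibility.
Variables (D : idomainType) (S : multset D).
Implicit Types (a b d e s t : D) (x y : (localization S : idomainType)).

Definition divides_upto a b : Prop := exists2 t, S t & divides a (t * b).

Lemma mset_neq0 s : S s -> s != 0.
Proof. by move=> Ss; apply/eqP => s0; apply: (@mset0 _ S); rewrite -s0. Qed.

(** Up to multiplication by S, elements of D_S are elements of D; as S consists
    of units of D_S, this does not affect divisibility. *)
Definition represents x d : Prop :=
  exists2 s, S s & val x * tofrac s = tofrac d.

Lemma represents_ex x : exists d, represents x d.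
Proof.
have /asboolP[d [s [Ss xE]]] := valP x.
by exists d, s => //; rewrite xE divfK// (mset_tofrac_neq0 Ss).
Qed.

Lemma represents_surj d : exists x, represents x d.
Proof.
have dP : tofrac d \in frac_by S.
  by apply/asboolP; exists d, 1; rewrite tofrac1 divr1; split=> //; apply: mset1.
by exists (Localize dP), 1; [apply: mset1 | rewrite tofrac1 mulr1].
Qed.

Lemma representsM x y d e :
  represents x d -> represents y e -> represents (x * y) (d * e).
Proof.
move=> [s Ss xE] [t St yE]; exists (s * t); first exact: msetM.
by rewrite rmorphM !tofracM -xE -yE mulrACA.
Qed.

Lemma represents_neq0 x d : represents x d -> x != 0 <-> d != 0.
Proof.
move=> [s Ss xE]; suff -> : (x == 0) = (d == 0) by [].
rewrite -(tofrac_eq0 d) -xE mulf_eq0.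
by rewrite (negPf (mset_tofrac_neq0 Ss)) orbF -(inj_eq val_inj) rmorph0.
Qed.

Lemma divides_localization x y d e :
  represents x d -> represents y e -> divides x y <-> divides_upto d e.
Proof.
move=> [s Ss xE] [t St yE].
have [sF tF] := (mset_tofrac_neq0 Ss, mset_tofrac_neq0 St).
split=> [[z yzx]|[r Sr [k rek]]].
  have [c [r Sr zE]] := represents_ex z.
  exists (r * s); [exact: msetM | exists (c * t)].
  apply/eqP; rewrite -tofrac_eq !tofracM -xE -yE -zE yzx rmorphM.
  by apply/eqP; ring.
have rF := mset_tofrac_neq0 Sr.
have zP : tofrac (k * s) / tofrac (r * t) \in frac_by S.
  by apply/asboolP; exists (k * s), (r * t); split=> //; apply: msetM.
exists (Localize zP); apply: val_inj; rewrite rmorphM /=.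
apply: (mulIf tF); apply: (mulfI rF); rewrite yE -tofracM rek !tofracM -xE.
have cancel (F : fieldType) (r' t' z k' s' : F) : r' != 0 -> t' != 0 ->
    k' * (z * s') = r' * (k' * s' / (r' * t') * z * t').
  by move=> r'0 t'0; field; rewrite r'0 t'0.
exact: cancel.
Qed.

Lemma v_domain_localizationE :
  v_domain (localization S) <-> multiplier_closed divides_upto.
Proof.
rewrite v_domainE; split=> [mL l [u ul u0] a b b0 ab|mD l [u ul u0] a b b0 ab].
  have [lift liftP] := choice represents_surj.
  apply: (divides_localization (liftP b) (liftP a)).1.
  apply: (mL (map lift l)).
  - exists (lift u); first exact: map_f.
    exact: (represents_neq0 (liftP u)).2 u0.
  - exact: (represents_neq0 (liftP b)).2 b0.
  move=> x y y0 xy _ /mapP[w wl ->].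
  have [[p xp] [q yq]] := (represents_ex x, represents_ex y).
  apply: (divides_localization (representsM (liftP b) yq)
    (representsM (representsM (liftP a) xp) (liftP w))).2.
  apply: ab wl => [|v vl]; first exact: (represents_neq0 yq).1 y0.
  apply: (divides_localization yq (representsM xp (liftP v))).1.
  by apply: xy; apply: map_f.
have [num numP] := choice represents_ex.
apply: (divides_localization (numP b) (numP a)).2; apply: (mD (map num l)).
- exists (num u); first exact: map_f.
  exact: (represents_neq0 (numP u)).1 u0.
- exact: (represents_neq0 (numP b)).1 b0.
move=> p q q0 pq _ /mapP[w wl ->].
have [[x xp] [y yq]] := (represents_surj p, represents_surj q).
apply: (divides_localization (representsM (numP b) yq)
  (representsM (representsM (numP a) xp) (numP w))).1.
apply: ab wl => [|v vl]; first exact: (represents_neq0 yq).2 q0.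
apply: (divides_localization yq (representsM xp (numP v))).2.
by apply: pq; apply: map_f.
Qed.

(** Finitely many elements that become divisible by q in D_S do so with a
    common factor from S; this is what makes the inverse of a finitely
    generated ideal commute with localization. *)
Lemma divides_upto_all q p (l : seq D) :
  (forall u, u \in l -> divides_upto q (p * u)) ->
  exists2 t, S t & forall u, u \in l -> divides q (t * p * u).
Proof.
elim: l => [|v l IH] pq; first by exists 1; first exact: mset1.
have [|t St tl] := IH; first by move=> u ul; apply: pq; rewrite inE ul orbT.
have [r Sr [k rk]] := pq v (mem_head _ _).
exists (r * t) => [|u]; first exact: msetM.
rewrite inE => /predU1P[->|/tl[e eE]].
  by exists (t * k); rewrite -[t * k * q]mulrA -rk; ring.
by exists (r * e); rewrite -[r * e * q]mulrA -eE; ring.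
Qed.

End LocalizationDivisibility.

(** * From D to D_S *)

(** If t divides d c, then c / t lies in (d, t)^-1, and (d, t)^-1 is contained
    in D because 1 belongs to its inverse (d, t)_v. *)
Lemma v_coprime_divides (D : idomainType) (d t c : D) : t != 0 ->
  ideal_v (set_in_frac (ideal_gen [:: d; t])) = @dom_in_frac D ->
  divides t (d * c) -> divides t c.
Proof.
move=> t0 dt tdc; apply/(dom_in_frac_div _ t0).
have : ideal_v (set_in_frac (ideal_gen [:: d; t])) 1.
  by rewrite dt; exists 1 => //; rewrite tofrac1.
move=> /(_ (tofrac c / tofrac t)); rewrite mul1r; apply.
apply/ideal_inv_gen => u; rewrite !inE => /orP[]/eqP->.
  by rewrite mulrAC -tofracM [c * d]mulrC; apply/dom_in_frac_div.
by rewrite divfK ?tofrac_eq0//; exists c.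
Qed.

Lemma splitting_setP (D : idomainType) (S : multset D) (d : D) :
  splitting_set S -> d != 0 ->
  exists d' s, [/\ d = d' * s, S s &
    forall t c, S t -> divides t (d' * c) -> divides t c].
Proof.
move=> [_ split] /split[d' [s [dE Ss cop]]]; exists d', s; split=> // t c St.
by apply: v_coprime_divides (cop t St); apply: mset_neq0 St.
Qed.

Lemma localization_multiplier_closed (D : idomainType) (S : multset D) :
  splitting_set S ->
  multiplier_closed (@divides D) -> multiplier_closed (divides_upto S).
Proof.
move=> splS mD l l0 a b b0 ab.
have [b' [s [bE Ss cop]]] := splitting_setP splS b0.
have b'0 : b' != 0 by apply: contra_neq b0; rewrite bE => ->; rewrite mul0r.
suff [k aE] : divides b' a by exists s => //; exists k; rewrite aE bE; ring.
apply: (mD l l0) => // p q q0 pq u ul.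
have pqS w : w \in l -> divides_upto S q (p * w).
  by move=> wl; exists 1; [exact: mset1 | rewrite mul1r; apply: pq].
have [[w puE] [t St [c tE]]] := (pq u ul, ab p q q0 pqS u ul).
(* With w = p u / q in D, the element a w / b' has the denominator b', and it
   also has the denominator t in S, because b = b' s and t a w = c b. *)
have apuE : a * p * u = a * w * q by rewrite -!mulrA -puE.
have {}tE : t * (a * w) = b' * (c * s).
  by apply: (mulIf q0); rewrite -mulrA -apuE tE bE; ring.
have [k ck] : divides t (c * s).
  by apply: cop => //; exists (a * w); rewrite -tE mulrC.
exists k; rewrite apuE mulrA; congr (_ * q).
by apply: (mulfI (mset_neq0 St)); rewrite tE ck; ring.
Qed.

(** * From D_S to D *)

(** If m is the least common multiple of s and x, their greatest common divisor
    is h = s x / m; the cofactors s' and x' are coprime in the strong sense of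
    the last clause since m = s x' = s' x divides x w as soon as s' divides
    x' w. *)
Lemma lcm_splitting_gcd (D : idomainType) (S : multset D) (s x : D) :
  lcm_splitting_set S -> S s -> x != 0 ->
  exists h s' x', [/\ s = h * s', x = h * x',
    forall u, divides u s -> divides u x -> divides u h &
    forall w, divides s' (x' * w) -> divides s' w].
Proof.
move=> [_ lcmS] Ss x0; have s0 := mset_neq0 Ss.
have [m sxm] := lcmS s x Ss x0.
have mP y : divides m y <-> divides s y /\ divides x y.
  by rewrite -!ideal_gen1 -sxm.
have [[x' mx'] [s' ms']] : divides s m /\ divides x m.
  by apply/mP; exists 1; rewrite mul1r.
have [h hE] : divides m (s * x).
  by apply/mP; split; [exists x; rewrite mulrC | exists s].
have sE : s = h * s' by apply: (mulIf x0); rewrite hE ms'; ring.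
have xE : x = h * x' by apply: (mulfI s0); rewrite hE mx'; ring.
exists h, s', x'; split=> // [u [a sa] [b xb]|w [k kE]].
  have [k kE] : divides m (a * x).
    by apply/mP; split; [exists b; rewrite xb sa; ring | exists a].
  have u0 : u != 0 by apply: contra_neq s0; rewrite sa => ->; rewrite mulr0.
  have m0 : m != 0.
    by apply: contra_neq s0; move/eqP: hE => /[swap] ->;
      rewrite mulr0 mulf_eq0 (negPf x0) orbF => /eqP.
  exists k; apply: (mulIf m0); rewrite -hE sa mulrAC kE; ring.
have [j jE] : divides m (x * w).
  by apply/mP; split; [exists k; rewrite xE sE -mulrA kE; ring
                      | exists w; rewrite mulrC].
by exists j; apply: (mulfI x0); rewrite jE ms'; ring.
Qed.

(** The greatest common divisor within S starts from the S-part of a nonzero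
    generator, which every element of S dividing that generator divides; each
    further generator then only requires a gcd with an element of S. *)
Lemma lcm_splitting_gcd_list (D : idomainType) (S : multset D) (l : seq D) :
  lcm_splitting_set S -> (exists2 u, u \in l & u != 0) ->
  exists g, [/\ S g, forall u, u \in l -> divides g u &
    forall t, S t -> (forall u, u \in l -> divides t u) -> divides t g].
Proof.
move=> lcmS [v vl v0]; have splS := lcmS.1.
have [v' [g0 [vE Sg0 cop]]] := splitting_setP splS v0.
suff [g [Sg gg0 gl gmax]] : exists g, [/\ S g, divides g g0,
    forall u, u \in l -> divides g u &
    forall t, divides t g0 -> (forall u, u \in l -> divides t u) ->
      divides t g].
  exists g; split=> // t St tl; apply: gmax => //; apply: cop => //.
  by rewrite -vE; apply: tl.
elim: l {vl} => [|u l [g [Sg [k gk] gl gmax]]].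
  by exists g0; split=> //; exists 1; rewrite mul1r.
have [->|u0] := eqVneq u 0.
  exists g; split=> // [|w|t tg0 tl]; first by exists k.
    by rewrite inE => /predU1P[->|/gl//]; exists 0; rewrite mul0r.
  by apply: gmax => // w wl; apply: tl; rewrite inE wl orbT.
have [h [g' [u' [gE uE hmax _]]]] := lcm_splitting_gcd lcmS Sg u0.
exists h; split=> [||w|t tg0 tl].
- by have := splS.1 h g'; rewrite -gE => /(_ Sg)[].
- by exists (k * g'); rewrite gk gE; ring.
- rewrite inE => /predU1P[->|/gl[e ->]]; first by exists u'; rewrite mulrC.
  by exists (e * g'); rewrite gE; ring.
- apply: hmax; last by apply: tl; rewrite mem_head.
  by apply: gmax => // w wl; apply: tl; rewrite inE wl orbT.
Qed.

Lemma multiplier_closed_of_localization (D : idomainType) (S : multset D) :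
  lcm_splitting_set S ->
  multiplier_closed (divides_upto S) -> multiplier_closed (@divides D).
Proof.
move=> lcmS mL l l0 a b b0 ab.
have [t St [c tac]] : divides_upto S b a.
  apply: (mL l l0) => // p q q0 /divides_upto_all[t St tl] u ul.
  have [k kE] := ab (t * p) q q0 tl u ul.
  by exists t => //; exists k; rewrite -kE; ring.
have [a0|a0] := eqVneq a 0; first by exists 0; rewrite a0 mul0r.
have c0 : c != 0.
  apply: contra_neq a0 => c0; apply: (mulfI (mset_neq0 St)).
  by rewrite tac c0 mul0r mulr0.
(* a / b = c / t = d / s in lowest terms *)
have [h [s [d [tE cE _ cop]]]] := lcm_splitting_gcd lcmS St c0.
have [Sh Ss] : S h /\ S s by apply: lcmS.1.1; rewrite -tE.
have sadb : s * a = d * b.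
  by apply: (mulfI (mset_neq0 Sh)); rewrite !mulrA -tE -cE.
have [g [Sg gl gmax]] := lcm_splitting_gcd_list lcmS l0.
have sgl u : u \in l -> divides (s * g) u.
  move=> ul; have [w uE] := gl u ul.
  (* 1 / g lies in A^-1, so (a / b) (u / g) = a w / b lies in D *)
  have [|k kE] := ab 1 g (mset_neq0 Sg) _ u ul.
    by move=> v vl; rewrite mul1r; apply: gl.
  have {}kE : a * w = k * b.
    by apply: (mulIf (mset_neq0 Sg)); rewrite -!mulrA -kE mulr1 uE.
  have [|e eE] := cop w; last by exists e; rewrite uE eE mulrA.
  by exists k; apply: (mulIf b0); rewrite mulrAC -sadb [RHS]mulrAC -kE; ring.
have [r rE] := gmax _ (msetM Ss Sg) sgl.
have rs1 : r * s = 1.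
  by apply: (mulIf (mset_neq0 Sg)); rewrite -mulrA -rE mul1r.
by exists (r * d); rewrite -mulrA -sadb mulrA rs1 mul1r.
Qed.

Theorem theorem0p3 (D : idomainType) (S : multset D) (hS : splitting_set S) :
  (v_domain D -> v_domain (localization S)) /\
  (lcm_splitting_set S -> (v_domain (localization S) <-> v_domain D)).
Proof.
have fwd : v_domain D -> v_domain (localization S).
  by rewrite v_domain_localizationE v_domainE; apply: localization_multiplier_closed.
split=> // lcmS; split=> //.
rewrite v_domain_localizationE v_domainE.
exact: multiplier_closed_of_localization.
Qed.
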